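(* Let $(\hat\Sigma,\sigma)$ and $(\Sigma,\sigma)$ be minimal subshifts and let $\pi\colon(\hat\Sigma,\sigma)\to(\Sigma,\sigma)$ be a topological factor map such that (1) $\pi$ is almost $1$-to-$1$, that is, there is $x\in\Sigma$ with $|\pi^{-1}(x)|=1$; (2) each fibre has at most $2$ elements, that is, $|\pi^{-1}(x)|\le 2$ for all $x\in\Sigma$. Let $D\subseteq\Sigma$ be the set of all $x\in\Sigma$ for which there are $y=(y_n)_{n\in\mathbb Z},z=(z_n)_{n\in\mathbb Z}\in\pi^{-1}(x)$ with $y_0\neq z_0$. Then $$S_D=\big[0,\sup_\mu\mu(D)\big],$$ where the supremum is taken over all invariant measures $\mu$ of $(\Sigma,\sigma)$.
   Context: A subshift is a pair $(\Sigma,\sigma)$ where $\Sigma\subseteq\mathcal A^{\mathbb Z}$ is closed (product topology) and shift-invariant for some finite alphabet $\mathcal A$, and $\sigma$ is the left shift; it is minimal if every $\sigma$-orbit $\{\sigma^\ell x\colon \ell\in\mathbb Z\}$ is dense. Alphabets of $\hat\Sigma$ and $\Sigma$ may differ. A (topological) factor map is a continuous surjection $\pi$ with $\pi\circ\sigma=\sigma\circ\pi$. An invariant measure is a Borel probability measure $\mu$ with $\mu(A)=\mu(\sigma A)$ for all Borel sets $A$. For $D\subseteq\Sigma$, $x\in\Sigma$ and $n\in\mathbb N=\{1,2,\ldots\}$ put $S_D^n(x)=\frac1n\sum_{i=0}^{n-1}\mathbf 1_D(\sigma^i x)$, and $$S_D=\bigcup_{x\in\Sigma}\ \bigcap_{N\in\mathbb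 N}\overline{\{S_D^n(x)\colon n\ge N\}}.$$ *)

(* Defs.v *)
From HB Require Import structures.
From mathcomp Require Import all_boot all_order all_algebra.
From mathcomp Require Import all_classical all_reals all_analysis.

Set Implicit Arguments.
Unset Strict Implicit.
Unset Printing Implicit Defensive.

Import Order.TTheory GRing.Theory Num.Theory.
Import numFieldNormedType.Exports.

Local Open Scope classical_set_scope.
Local Open Scope ring_scope.

(* A is a discrete space; its finiteness is part of [subshift] below. *)
Definition full_shift (A : pdiscreteTopologicalType) : Type :=
  {ptws int -> A}.

HB.instance Definition _ (A : pdiscreteTopologicalType) :=
  Pointed.on (full_shift A).
HB.instance Definition _ (A : pdiscreteTopologicalType) :=
  Nbhs.on (full_shift A).
HB.instance Definition _ (A : pdiscreteTopologicalType) :=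
  Topological.on (full_shift A).

Notation borel A := (g_sigma_algebraType (@open (full_shift A))).

Section subshifts.
Context {A : pdiscreteTopologicalType}.
Implicit Types (x : full_shift A) (S D : set (full_shift A)).

Definition left_shift x : full_shift A := fun n => x (n + 1).

(* The l-th power of the left shift, l an integer; see [iter_shift]. *)
Definition shiftz (l : int) x : full_shift A := fun n => x (n + l).

Lemma shiftzD (l m : int) x : shiftz (l + m) x = shiftz l (shiftz m x).
Proof. by apply/funext => n; rewrite /shiftz addrA. Qed.

Lemma iter_shift (i : nat) x : iter i left_shift x = shiftz i%:Z x.
Proof.
elim: i => [|i IH]; first by apply/funext => n; rewrite /shiftz addr0.
rewrite iterS IH /left_shift /shiftz; apply/funext => n.
by rewrite -addn1 PoszD -addrA (addrC 1).
Qed.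

Definition orbit x : set (full_shift A) := range (shiftz ^~ x).

Definition subshift S : Prop :=
  [/\ finite_set [set: A], closed S & left_shift @` S = S].

Definition minimal S : Prop := forall x, S x -> S `<=` closure (orbit x).

Definition visit_freq {R : realType} D (n : nat) x : R :=
  n%:R^-1 * \sum_(0 <= i < n) \1_D (iter i left_shift x).

Definition limit_freqs {R : realType} S D : set R :=
  \bigcup_(x in S) \bigcap_(N in [set N | (0 < N)%N])
    closure [set visit_freq D n x | n in [set n | (N <= n)%N]].

(* S being closed, its Borel sets are the Borel sets of the full shift that
   are contained in S, and a Borel probability measure on S is a Borel
   probability measure on the full shift giving mass 1 to S. *)
Definition invariant_measure {R : realType} S (mu : probability (borel A) R) :
    Prop :=
  mu S = 1%E /\
  forall B : set (borel A), measurable B -> B `<=` S -> mu B = mu (left_shift @` B).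

End subshifts.

Section factor_maps.
Context {B A : pdiscreteTopologicalType}.
Variables (hatS : set (full_shift B)) (S : set (full_shift A)).
Variable pi : full_shift B -> full_shift A.

(* Only the restriction of pi to hatS is relevant. *)
Definition factor_map : Prop :=
  [/\ {within hatS, continuous pi}, pi @` hatS = S &
      forall y, hatS y -> pi (left_shift y) = left_shift (pi y)].

Definition fibre (x : full_shift A) : set (full_shift B) :=
  hatS `&` pi @^-1` [set x].

Definition split_set : set (full_shift A) :=
  [set x | S x /\
     exists y z, [/\ fibre x y, fibre x z & y (0 : int) <> z (0 : int)]].

End factor_maps.

(* Main.v *)
Require Import Defs.
From HB Require Import structures.
From mathcomp Require Import all_boot all_order all_algebra.
From mathcomp Require Import all_classical all_reals all_analysis.
From mathcomp Require Import measurable_realfun.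
From mathcomp Require Import zify ring lra.

Set Implicit Arguments.
Unset Strict Implicit.
Unset Printing Implicit Defensive.

Import Order.TTheory GRing.Theory Num.Theory.
Import numFieldNormedType.Exports.

Local Open Scope classical_set_scope.
Local Open Scope ring_scope.

(** Two points y, z of hatS in the same fibre have a pattern, the binary
    sequence i |-> [y_i <> z_i] over i >= 0.  The patterns form a one-sided
    binary subshift.  Because a fibre has at most two elements, a nonzero
    pattern of y and z is exactly the sequence of times at which pi y visits D
    ([pattern_visit]), and the visits of any x in S to D form a pattern
    ([visit_pattern]).  The theorem thus asks which densities patterns have.

    No density exceeds the supremum: the frequencies along an orbit converge,
    along an ultrafilter, to a shift-invariant finitely additive mean on all
    subsets of the full shift.  By compactness its restriction to cylinders
    extends to an invariant measure, which gives to the closed set D at least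
    the limit frequency ([limit_freq_measure]).

    The density 0 is that of the point with a singleton fibre, which never
    visits D.  Let a > 0 be at most the supremum.  Integrating the number of
    visits shows that for each n some pattern has at least a n ones among its
    first n entries ([visit_bound]), a property called heavy below; and since
    every orbit in S comes close to the point with a singleton fibre, every
    pattern contains arbitrarily long blocks of zeros ([zero_patterns]).  These
    two facts suffice to find a density a ([intermediate_density]), as follows.

    Pass to a heavy subshift F of patterns in which no word can be forbidden
    without losing heaviness ([reduced_exists]).  It contains a sequence p all
    of whose initial segments have density at least a ([heavy_point]).  A
    sequence of F with eventually such densities visits every word of F
    infinitely often, as otherwise its late tails would show that the
    subshift avoiding that word is heavy ([recurrent]).  Suppose that some word
    u of F had no long continuation in F of density close to a.  Then all long
    continuations of u along p have density above a.  Consider the last visit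
    of p to u before a long block of zeros: as the block grows, these visits
    accumulate at a sequence of F that starts with u, has densities above a and
    never returns to u, contrary to recurrence.  So every word of F extends to
    arbitrarily long words of density close to a ([balanced_extension]), and a
    nested sequence of such words defines the required pattern. *)

(** * Compactness over a finite alphabet *)

(** Sequential compactness of the product, through values that an ultrafilter
    selects coordinate by coordinate.  No topology on the alphabet is involved,
    so that it applies equally to binary sequences and to pairs of points. *)
Lemma cluster_point (I : eqType) (T : choiceType) (p : nat -> I -> T) :
  finite_set [set: T] ->
  exists q : I -> T, forall (s : seq I) N,
    exists2 k, (N <= k)%N & forall i, i \in s -> p k i = q i.
Proof.
move=> /finite_seqP[e eT].
have [G [GU ooG]] := @ultraFilterLemma _ (\oo : set_system nat) _.
have val i : exists t, G [set k | p k i = t].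
  apply: contrapT => nG.
  have G_notin (s : seq T) : G [set k | p k i \notin s].
    elim: s => [|t s IH]; first by apply: filterS filterT.
    have [Gt|Gt] := in_ultra_setVsetC [set k | p k i = t] GU.
      by case: nG; exists t.
    apply: filterS (filterI Gt IH) => k /= [/eqP pkt pks].
    by rewrite in_cons negb_or pkt.
  have /filter_ex[k] := G_notin e.
  move=> /= /negP; apply.
  by rewrite -[is_true _]/([set` e] _) -eT.
have [q qP] := choice val.
exists q => s N.
have : G [set k | (N <= k)%N /\ forall i, i \in s -> p k i = q i].
  apply: filterI; first by apply: ooG; exact: nbhs_infty_ge.
  elim: s => [|i s IH]; first by apply: filterS filterT.
  apply: filterS (filterI (qP i) IH) => k /= [pki IHk] j.
  by rewrite in_cons => /predU1P[->//|/IHk].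
by move=> /filter_ex[k [Nk pk]]; exists k.
Qed.

(** * Binary sequences of intermediate density *)

Definition hits (p : nat -> bool) (n : nat) : nat := \sum_(0 <= i < n) p i.

Definition tail (k : nat) (p : nat -> bool) : nat -> bool := fun i => p (k + i)%N.

Definition agree (n : nat) (p q : nat -> bool) := forall i, (i < n)%N -> p i = q i.

Definition prefixed (u : seq bool) (p : nat -> bool) :=
  forall i, (i < size u)%N -> p i = nth false u i.

Lemma tail_tail k l p : tail k (tail l p) = tail (l + k) p.
Proof. by apply/funext => i; rewrite /tail addnA. Qed.

Lemma hits0 p : hits p 0 = 0%N. Proof. by rewrite /hits big_geq. Qed.

Lemma hitsS p n : hits p n.+1 = (hits p n + p n)%N.
Proof. by rewrite /hits big_nat_recr. Qed.

Lemma hits_add p k n : hits p (k + n) = (hits p k + hits (tail k p) n)%N.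
Proof.
elim: n => [|n IH]; first by rewrite addn0 hits0 addn0.
by rewrite addnS !hitsS IH addnA.
Qed.

Lemma hits_le p n : (hits p n <= n)%N.
Proof. by elim: n => [|n IH]; rewrite ?hits0// hitsS; case: (p n); lia. Qed.

Lemma agree_hits n p q : agree n p q -> hits p n = hits q n.
Proof. by move=> pq; apply: eq_big_nat => i /andP[_ /pq ->]. Qed.

Lemma hits_eq0 p n : (forall i, (i < n)%N -> p i = false) -> hits p n = 0%N.
Proof. by move=> p0; rewrite /hits big_nat big1// => i /andP[_ /p0 ->]. Qed.

Lemma prefixed_mkseq p n q : prefixed (mkseq p n) q <-> agree n q p.
Proof.
rewrite /prefixed size_mkseq; split => + i iN => /(_ i iN).
  by rewrite nth_mkseq.
by move=> ->; rewrite nth_mkseq.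
Qed.

Lemma cluster_binary (p : nat -> nat -> bool) :
  exists q, forall n N, exists2 k, (N <= k)%N & agree n (p k) q.
Proof.
have [q qP] := @cluster_point nat bool p (@finite_finset bool _).
exists q => n N; have [k Nk pkq] := qP (iota 0 n) N.
by exists k => // i iN; apply: pkq; rewrite mem_iota.
Qed.

Record binary_subshift (F : set (nat -> bool)) : Prop := BinarySubshift {
  bs_closed : forall q, (forall n, exists2 p, F p & agree n p q) -> F q ;
  bs_tail : forall p k, F p -> F (tail k p) }.

Definition heavy {R : realType} (a : R) (F : set (nat -> bool)) :=
  forall n, exists2 p, F p & a * n%:R <= (hits p n)%:R.

Definition avoiding (u : seq bool) : set (nat -> bool) :=
  [set p | forall k, ~ prefixed u (tail k p)].

Lemma avoiding_subshift F u :
  binary_subshift F -> binary_subshift (F `&` avoiding u).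
Proof.
move=> [Fcl Fk]; split=> [q qF|p k [Fp pu]]; last first.
  by split; [exact: Fk|move=> l; rewrite tail_tail; exact: pu].
split; first by apply: Fcl => n; have [p [Fp _] pq] := qF n; exists p.
move=> k uq; have [p [_ pu] pq] := qF (k + size u)%N.
by apply: (pu k) => i iu; rewrite -uq// /tail pq// ltn_add2l.
Qed.

Lemma heavyS {R : realType} (a : R) (F G : set (nat -> bool)) :
  F `<=` G -> heavy a F -> heavy a G.
Proof. by move=> FG hF n; have [p /FG Gp pa] := hF n; exists p. Qed.

(** A count below [a * m] stays below by a uniform margin, since for [m <= L]
    only finitely many integers matter.  This turns a strict inequality that
    holds at every position into a loss that adds up linearly. *)
Lemma integer_gap {R : realType} (a : R) (L : nat) : exists2 e : R, 0 < e &
  forall m c : nat, (m <= L)%N -> c%:R < a * m%:R -> c%:R <= a * m%:R - e.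
Proof.
have one m : exists2 e : R, 0 < e &
    forall c : nat, c%:R < a * m%:R -> c%:R <= a * m%:R - e.
  have [am|am] := leP (a * m%:R) 0.
    by exists 1 => // c; have := ler0n R c; lra.
  pose c0 := Num.truncn (a * m%:R).
  have /andP[c0a ac0] := truncn_itv (ltW am).
  case: (ltrP c0%:R (a * m%:R)) => c0m.
    exists (a * m%:R - c0%:R); first by lra.
    move=> c ca; rewrite subKr ler_nat -ltnS -(ltr_nat R).
    exact: lt_le_trans ca (ltW ac0).
  exists 1 => // c ca.
  have : (c.+1 <= c0)%N by rewrite -(ltr_nat R); lra.
  rewrite -(ler_nat R) -natr1; lra.
elim: L => [|L [e e0 eP]].
  have [e e0 eP] := one 0%N; exists e => // m c.
  by rewrite leqn0 => /eqP ->; exact: eP.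
have [e' e'0 e'P] := one L.+1.
exists (Num.min e e'); first by rewrite lt_min e0.
move=> m c; rewrite leq_eqVlt => /predU1P[->|mL] cm.
  by apply: le_trans (e'P _ cm) _; rewrite lerB// ge_min lexx orbT.
by apply: le_trans (eP _ _ mL cm) _; rewrite lerB// ge_min lexx.
Qed.

Lemma natr_unbounded {R : realType} (e C : R) (N : nat) : 0 < e ->
  exists2 n, (N <= n)%N & C < e * n%:R.
Proof.
move=> e0; exists (maxn N (Num.truncn (C / e)).+1); first exact: leq_maxl.
rewrite mulrC -ltr_pdivrMr//.
by rewrite (lt_le_trans (truncnS_gt _))// ler_nat leq_maxr.
Qed.

Section reduced.
Context {R : realType} (a : R).
Hypothesis a_ge0 : 0 <= a.
Implicit Types F : set (nat -> bool).

(** A substitute for minimality among heavy subshifts: there are countably many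
    words, so an enumeration of them replaces Zorn's lemma. *)
Definition reduced F := forall u p, F p -> prefixed u p ->
  ~ heavy a (F `&` avoiding u).

(** Go through all words and forbid each one whose absence preserves heaviness.
    The intersection is heavy by compactness, because whether a sequence has
    [a * n] ones among its first [n] entries depends on a prefix. *)
Lemma reduced_exists X : binary_subshift X -> heavy a X ->
  exists F, [/\ F `<=` X, binary_subshift F, heavy a F & reduced F].
Proof.
move=> bX hX.
pose word k : seq bool := odflt [::] (unpickle k).
pose step k F := let G := F `&` avoiding (word k) in
  if `[< heavy a G >] then G else F.
pose Fs := fix Fs k := if k is k'.+1 then step k' (Fs k') else X.
have FsP k : binary_subshift (Fs k) /\ heavy a (Fs k).
  elim: k => //= k [bF hF]; rewrite /step; case: asboolP => // hG; split=> //.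
  exact: avoiding_subshift.
have FsS k : Fs k.+1 `<=` Fs k.
  by move=> p; rewrite /= /step; case: asboolP => // _ [].
have Fs_le j k : (j <= k)%N -> Fs k `<=` Fs j.
  move=> /subnK <-; elim: (k - j)%N => // l IH p.
  by rewrite addSn => /FsS /IH.
exists (\bigcap_k Fs k); split.
- by move=> p /(_ 0%N I).
- split=> [q qF k _|p l Fp k _].
    apply: (bs_closed (FsP k).1) => n; have [p Fp pq] := qF n.
    by exists p => //; exact: Fp.
  by apply: (bs_tail (FsP k).1); exact: Fp.
- move=> n.
  have /choice[p pP] k : exists p, Fs k p /\ a * n%:R <= (hits p n)%:R.
    by have [_ /(_ n)[p]] := FsP k; exists p.
  have [q qP] := cluster_binary p.
  exists q; last by have [k _ /agree_hits <-] := qP n 0%N; exact: (pP k).2.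
  move=> j _; apply: (bs_closed (FsP j).1) => m.
  by have [k jk pq] := qP m j; exists (p k) => //; exact: (Fs_le _ _ jk) (pP k).1.
- move=> u p Fp up hu; have := Fp (pickle u).+1 I.
  have hG : heavy a (Fs (pickle u) `&` avoiding u).
    by apply: heavyS hu => q [Fq ?]; split=> //; exact: Fq.
  by rewrite /= /step /word pickleK /= asboolT// => -[_ /(_ 0%N)].
Qed.

(** If from some time on every window of length [n] had fewer than [a * n] ones,
    it would miss [a * n] by a fixed margin, and cutting a long initial segment
    into such windows would push its density below [a]. *)
Lemma late_heavy p N : (forall m, (N <= m)%N -> a * m%:R <= (hits p m)%:R) ->
  forall K n, exists2 k, (K <= k)%N & a * n%:R <= (hits (tail k p) n)%:R.
Proof.
move=> pN K n; apply: contrapT => nk.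
have lt_an k : (K <= k)%N -> (hits (tail k p) n)%:R < a * n%:R.
  by move=> Kk; rewrite ltNge; apply/negP => ?; apply: nk; exists k.
have n0 : (0 < n)%N.
  by case: n {nk} lt_an => // /(_ K (leqnn _)); rewrite hits0 mulr0 ltxx.
have [e e0 eP] := integer_gap a n.
have bound j : (hits p (K + j * n))%:R <= K%:R + j%:R * (a * n%:R - e).
  elim: j => [|j IH]; first by rewrite addn0 mul0r addr0 ler_nat hits_le.
  have := eP _ _ (leqnn n) (lt_an (K + j * n)%N (leq_addr _ _)).
  rewrite mulSn (addnC n) addnA hits_add natrD -natr1; lra.
have [j Nj Cj] := @natr_unbounded R e K%:R N e0.
have Njn : (N <= K + j * n)%N.
  by rewrite (leq_trans Nj)// (leq_trans (leq_pmulr j n0))// leq_addl.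
have := le_trans (pN _ Njn) (bound j).
rewrite natrD natrM; have : 0 <= a * K%:R by rewrite mulr_ge0.
lra.
Qed.

(** A maximal ergodic argument.  If within [L] steps every sequence had an
    initial segment of density below [a], greedy cutting into such segments
    would bound all long densities away from [a], against heaviness.  So for
    each [L] there is a sequence that is good up to [L]; take a limit. *)
Lemma heavy_point F : binary_subshift F -> heavy a F ->
  exists2 p, F p & forall m, a * m%:R <= (hits p m)%:R.
Proof.
move=> bF hF.
have upto L : exists p, F p /\ forall m, (m <= L)%N -> a * m%:R <= (hits p m)%:R.
  apply: contrapT => np.
  have drop p : F p -> exists2 m, (m <= L)%N & (hits p m)%:R < a * m%:R.
    move=> Fp; apply: contrapT => nm; apply: np; exists p; split=> // m mL.
    by rewrite leNgt; apply/negP => ?; apply: nm; exists m.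
  have [e e0 eP] := integer_gap a L.
  (* a loss of e in each piece of length at most L is a loss of rate d *)
  pose d := e / L.+1%:R.
  have d0 : 0 < d by rewrite divr_gt0.
  have ed : e = d * L.+1%:R by rewrite divfK.
  have bound n p : F p -> (hits p n)%:R <= (a - d) * n%:R + (L.+1%:R + e).
    elim/ltn_ind: n p => n IH p Fp; have [nL|Ln] := leqP n L.
      have : (hits p n)%:R <= L.+1%:R :> R.
        by rewrite ler_nat (leq_trans (hits_le _ _))// ltnW.
      have : d * n%:R <= e by rewrite ed ler_pM2l// ler_nat ltnW.
      have : 0 <= a * n%:R by rewrite mulr_ge0.
      lra.
    have [m mL pm] := drop p Fp.
    have m0 : (0 < m)%N by case: m pm {mL} => //; rewrite hits0 mulr0 ltxx.
    have mn : (m < n)%N by exact: leq_ltn_trans mL Ln.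
    have dm : d * m%:R <= e by rewrite ed ler_pM2l// ler_nat ltnW.
    have := IH (n - m)%N _ (tail m p) (bs_tail bF _ Fp).
    rewrite ltn_subrL m0 (leq_ltn_trans _ mn)// => /(_ isT).
    have := eP _ _ mL pm.
    rewrite -{3}(subnKC (ltnW mn)) hits_add natrD natrB ?(ltnW mn)//.
    lra.
  have [n _ nP] := @natr_unbounded R d (L.+1%:R + e) 0 d0.
  have [p Fp pn] := hF n; have := le_trans pn (bound n p Fp); lra.
have [p pP] := choice upto.
have [q qP] := cluster_binary p.
exists q.
  apply: (bs_closed bF) => n; have [k _ pq] := qP n 0%N.
  by exists (p k) => //; exact: (pP k).1.
move=> m; have [k mk /agree_hits <-] := qP m m.
exact: (pP k).2.
Qed.

(** After the last visit to [u] all tails of [p] would lie in the subshift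
    avoiding [u], which [late_heavy] would make heavy. *)
Lemma recurrent F p u r N : binary_subshift F -> reduced F ->
  F p -> (forall m, (N <= m)%N -> a * m%:R <= (hits p m)%:R) ->
  F r -> prefixed u r ->
  forall K, exists2 k, (K <= k)%N & prefixed u (tail k p).
Proof.
move=> bF rF Fp pN Fr ur K; apply: contrapT => nu.
apply: (rF u r Fr ur) => n.
have [k Kk pk] := late_heavy pN K n.
exists (tail k p) => //; split; first exact: bs_tail.
move=> l; rewrite tail_tail => ul; apply: nu.
by exists (k + l)%N => //; rewrite (leq_trans Kk)// leq_addr.
Qed.

End reduced.

Section intermediate_density.
Context {R : realType} (a : R).
Hypothesis a_ge0 : 0 <= a.
Implicit Types F : set (nat -> bool).

Definition zero_blocks F :=
  forall p L, F p -> exists s, forall i, (i < L)%N -> p (s + i)%N = false.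

(** The walk whose value at [n], divided by [n], is the deviation of the density
    from [a]; its upward steps are at most 1. *)
Definition excess (p : nat -> bool) n : R := (hits p n)%:R - a * n%:R.

Lemma excess_add p k n : excess p (k + n) = excess p k + excess (tail k p) n.
Proof. by rewrite /excess hits_add !natrD; ring. Qed.

Lemma excess_step p n : excess p n.+1 <= excess p n + 1.
Proof.
rewrite /excess hitsS natrD -natr1; have : (p n : nat)%:R <= 1 :> R by case: (p n).
by move: a_ge0; lra.
Qed.

Lemma agree_excess n p q : agree n p q -> excess p n = excess q n.
Proof. by rewrite /excess => /agree_hits ->. Qed.

(** The key step.  If the claim fails then, past a time [N0] where [d * N0]
    exceeds the size of an upward step, the excess of a sequence starting with
    [u] cannot jump over the forbidden band from below: once negative, it stays
    negative.  Along the recurrent sequence [p] the excess after a visit to [u]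
    is bounded below, hence positive from [N0] on.  The last visits to [u]
    before longer and longer zero blocks then converge to a sequence that
    contradicts [recurrent]. *)
Lemma balanced_extension F u r : binary_subshift F -> heavy a F ->
    reduced a F -> zero_blocks F -> F r -> prefixed u r ->
  forall (d : R) N, 0 < d -> exists q m,
    [/\ F q, prefixed u q, (N <= m)%N & `|excess q m| <= d * m%:R].
Proof.
move=> bF hF rF zF Fr ur d N d0; apply: contrapT => nb.
have [p Fp pa] := heavy_point a_ge0 bF hF.
have [N0 NN0 dN0] := natr_unbounded 1 N d0.
have far q m : F q -> prefixed u q -> (N0 <= m)%N -> d * m%:R < `|excess q m|.
  move=> Fq uq Nm; rewrite ltNge; apply/negP => qm; apply: nb.
  by exists q, m; split=> //; exact: leq_trans Nm.
have far1 m : (N0 <= m)%N -> 1 < d * m%:R.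
  by move=> Nm; rewrite (lt_le_trans dN0)// ler_pM2l// ler_nat.
have neg q m : F q -> prefixed u q -> (N0 <= m)%N -> excess q m < 0 ->
    forall l, excess q (m + l) < 0.
  move=> Fq uq Nm qm; elim=> [|l IH]; first by rewrite addn0.
  have Nml : (N0 <= m + l)%N by rewrite (leq_trans Nm)// leq_addr.
  have := far q _ Fq uq Nml; rewrite ltr0_norm// addnS.
  by have := excess_step q (m + l); have := far1 _ Nml; lra.
have pos k m : prefixed u (tail k p) -> (N0 <= m)%N -> 0 < excess (tail k p) m.
  move=> uk Nm; have Fk : F (tail k p) by exact: bs_tail.
  rewrite ltNge; apply/negP => le0.
  have lt0 : excess (tail k p) m < 0.
    rewrite lt_neqAle le0 andbT; apply/eqP => e0.
    have := far _ _ Fk uk Nm; have := far1 _ Nm; rewrite e0 normr0; lra.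
  have [n mn nP] := natr_unbounded (excess p k) m d0.
  have Nn := leq_trans Nm mn.
  have := neg _ _ Fk uk Nm lt0 (n - m)%N; rewrite subnKC// => ltn0.
  have := far _ _ Fk uk Nn; rewrite ltr0_norm//.
  have : 0 <= excess p (k + n) by rewrite subr_ge0.
  rewrite excess_add; lra.
have escape L : exists q, [/\ F q, prefixed u q,
    forall m, (N0 <= m)%N -> 0 < excess q m &
    forall k, (0 < k <= L)%N -> ~ prefixed u (tail k q)].
  have [k0 _ uk0] := recurrent (N := 0) a_ge0 bF rF Fp (fun m _ => pa m) Fr ur 0.
  have [s sP] := zF (tail k0 p) (L + N0)%N (bs_tail bF k0 Fp).
  have k0P : `[< prefixed u (tail k0 p) >] && (k0 <= k0 + s + L)%N.
    by rewrite asboolT// -addnA leq_addr.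
  (* k is the last visit to u that leaves N0 zeros of the block ahead *)
  have [k /andP[/asboolP uk ks] kmax] := @ex_maxnP
    (fun k => `[< prefixed u (tail k p) >] && (k <= k0 + s + L)%N) (k0 + s + L)
    (ex_intro _ k0 k0P) (fun k kP => proj2 (andP kP)).
  exists (tail k p); split=> //; first exact: bs_tail.
    by move=> m; exact: pos.
  move=> j /andP[j0 jL]; rewrite tail_tail => uj.
  have k_lt : (k < k0 + s)%N.
    rewrite ltnNge; apply/negP => sk.
    have := pos k N0 uk (leqnn _); rewrite /excess hits_eq0.
      have : 0 <= a * N0%:R by rewrite mulr_ge0.
      by lra.
    move=> i iN; have := sP (k - (k0 + s) + i)%N.
    rewrite /tail (_ : (k0 + (s + (k - (k0 + s) + i)) = k + i)%N); last by lia.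
    by apply; lia.
  suff : (k + j <= k)%N by lia.
  by apply: kmax; rewrite asboolT//=; lia.
have /choice[e eP] := escape.
have [q qP] := cluster_binary e.
have Fq : F q.
  apply: (bs_closed bF) => n; have [k _ kq] := qP n 0%N.
  by exists (e k) => //; have [] := eP k.
have uq : prefixed u q.
  have [k _ kq] := qP (size u) 0%N => i iu.
  by rewrite -kq//; have [_ ->] := eP k.
have [] := recurrent (p := q) (N := N0) a_ge0 bF rF Fq _ Fr ur 1.
  move=> m Nm; have [k _ kq] := qP m 0%N.
  have [_ _ /(_ m Nm) + _] := eP k.
  by rewrite (agree_excess kq) subr_gt0 => /ltW.
move=> k k0 uk; have [l kl lq] := qP (k + size u)%N k.
have [_ _ _ /(_ k)] := eP l; rewrite k0 => /(_ kl); apply => i iu.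
by rewrite -uk// /tail lq// ltn_add2l.
Qed.

(** Iterate [balanced_extension]: a state is a sequence of [F] together with the
    length of the prefix kept for ever, and the [j]-th step extends this prefix
    to one whose density is within [1 / j.+1] of [a]. *)
Theorem intermediate_density X : binary_subshift X -> heavy a X ->
    zero_blocks X ->
  exists2 q, X q & forall (d : R) N, 0 < d ->
    exists2 m, (N <= m)%N & `|excess q m| <= d * m%:R.
Proof.
move=> bX hX zX.
have [F [FX bF hF rF]] := reduced_exists bX hX.
have zF : zero_blocks F by move=> p L /FX; exact: zX.
pose good (j : nat) (x y : (nat -> bool) * nat) :=
  [/\ F y.1, agree x.2 y.1 x.1, (x.2 < y.2)%N &
      `|excess y.1 y.2| <= j.+1%:R^-1 * y.2%:R].
have /choice[f fP] (jx : nat * ((nat -> bool) * nat)) :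
    exists y, F jx.2.1 -> good jx.1 jx.2 y.
  case: jx => j [p m] /=; have [Fp|?] := pselect (F p); last by exists (p, m).
  have up : prefixed (mkseq p m) p by apply/prefixed_mkseq.
  have j0 : 0 < j.+1%:R^-1 :> R by rewrite invr_gt0.
  have [q [m' [Fq /prefixed_mkseq qp mm' qm']]] :=
    balanced_extension bF hF rF zF Fp up m.+1 j0.
  by exists (q, m').
have [p0 Fp0 _] := hF 0%N.
pose st := fix st j := if j is j'.+1 then f (j', st j') else (p0, 0%N).
have Fst j : F (st j).1.
  by elim: j => //= j IH; have [] := fP (j, st j) IH.
have stS j : good j (st j) (st j.+1) by exact: fP (j, st j) (Fst j).
have m_lt j : ((st j).2 < (st j.+1).2)%N by have [] := stS j.
have le_m j k : (j <= k)%N -> ((st j).2 <= (st k).2)%N.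
  move=> /subnK <-; elim: (k - j)%N => // l IH.
  by rewrite addSn (leq_trans IH)// ltnW.
have j_le j : (j <= (st j).2)%N.
  by elim: j => // j IH; exact: leq_ltn_trans IH (m_lt j).
have agr j k : (j <= k)%N -> agree (st j).2 (st k).1 (st j).1.
  move=> /subnK <-; elim: (k - j)%N => // l IH i ij.
  have [_ + _ _] := stS (l + j)%N; rewrite addSn => ->; first exact: IH.
  by rewrite (leq_trans ij)// le_m// leq_addl.
(* the diagonal: the prefix kept at step i.+1 is longer than i *)
pose q i := (st i.+1).1 i.
have qst j : agree (st j).2 q (st j).1.
  move=> i ij; have [ji|ij'] := leqP j i.+1; first exact: agr.
  by rewrite /q -(agr _ _ (ltnW ij'))//; exact: j_le.
exists q.
  apply/FX/(bs_closed bF) => n; exists (st n).1 => // i iN.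
  by rewrite (qst n)// (leq_trans iN).
move=> d N d0; have [j Nj jd] := natr_unbounded 1 N d0.
exists (st j.+1).2; first by rewrite (leq_trans Nj)// ltnW.
rewrite (agree_excess (qst _)); have [_ _ _ /le_trans] := stS j; apply.
apply: ler_wpM2r => //; rewrite -[leLHS]mul1r ler_pdivrMr//.
by rewrite (le_trans (ltW jd))// ler_pM2l// ler_nat.
Qed.

End intermediate_density.

(** * Full shifts and their windows *)

Section windows.
Context {A : pdiscreteTopologicalType}.
Implicit Types (x y : full_shift A) (C O : set (full_shift A)).

(** Cylinder neighbourhoods: the following lemmas reduce all the topology of the
    full shift to agreement on the coordinates of absolute value at most [n]. *)
Definition window (n : nat) x y := forall i : int, (`|i| <= n)%N -> y i = x i.

Lemma window_le m n x y : (m <= n)%N -> window n x y -> window m x y.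
Proof. by move=> mn xy i im; apply: xy; exact: leq_trans mn. Qed.

Lemma windowC n x y : window n x y -> window n y x.
Proof. by move=> xy i /xy. Qed.

Lemma window_trans n x y z : window n x y -> window n y z -> window n x z.
Proof. by move=> xy yz i iN; rewrite yz// xy. Qed.

Lemma window_eq x y : (forall n, window n x y) -> y = x.
Proof. by move=> xy; apply/funext => i; exact: (xy `|i|%N). Qed.

Lemma window_shiftz n l x y :
  window (n + `|l|) x y -> window n (shiftz l x) (shiftz l y).
Proof. by move=> xy i iN; apply: xy; lia. Qed.

Lemma nbhs_windowP x (P : set (full_shift A)) :
  nbhs x P <-> exists n, forall y, window n x y -> P y.
Proof.
split; last first.
  move=> [n nP].
  pose s := [seq k%:Z - n%:Z | k <- iota 0 (n + n).+1].
  have : nbhs x [set y | forall i, i \in s -> y i = x i].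
    elim: s => [|i s IH]; first by apply: filterS filterT.
    have Hi : nbhs x [set y | y i = x i].
      have /(_ [set x i]) := @proj_continuous int (fun=> A) i x.
      by apply; exact: discrete_set1.
    apply: filterS (filterI Hi IH) => y [yi ys] j.
    by rewrite in_cons => /predU1P[->//|]; exact: ys.
  apply: filterS => y ys; apply: nP => i iN; apply: ys.
  apply/mapP; exists (absz (i + n%:Z)); last by lia.
  by rewrite mem_iota; lia.
pose F : set_system (full_shift A) :=
  filter_from [set: nat] (fun n => [set y | window n x y]).
have FF : Filter F.
  apply: filter_from_filter; first by exists 0%N.
  move=> m n _ _; exists (maxn m n) => // y xy.
  by split; apply: window_le xy; rewrite ?leq_maxl ?leq_maxr.
have : F --> x.
  apply/cvg_sup => i U [V] [[W] oW <-] Wx WU.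
  apply: (filterS WU); exists `|i|%N => // y xy.
  by rewrite /= /proj xy.
by move=> /[apply] -[n _ nP]; exists n.
Qed.

Lemma open_windowP O :
  open O <-> forall x, O x -> exists n, forall y, window n x y -> O y.
Proof.
rewrite openE; split=> oO x Ox; first by apply/nbhs_windowP; exact: oO.
by apply/nbhs_windowP; exact: oO.
Qed.

Lemma closed_windowP C :
  closed C <-> forall x, (forall n, exists2 y, C y & window n x y) -> C x.
Proof.
split=> clC x Cx.
  apply: clC => P /nbhs_windowP[n nP]; have [y Cy /nP Py] := Cx n.
  by exists y.
apply: clC => n.
have [y [Cy xy]] : C `&` [set y | window n x y] !=set0.
  by apply: Cx; apply/nbhs_windowP; exists n.
by exists y.
Qed.

Lemma cluster_windows (T : choiceType) (p : nat -> int -> T) :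
  finite_set [set: T] ->
  exists q : int -> T, forall n N,
    exists2 k, (N <= k)%N & forall i : int, (`|i| <= n)%N -> p k i = q i.
Proof.
move=> /(cluster_point p)[q qP]; exists q => n N.
have [k Nk pq] := qP [seq k%:Z - n%:Z | k <- iota 0 (n + n).+1] N.
exists k => // i iN; apply: pq; apply/mapP.
by exists (absz (i + n%:Z)); rewrite ?mem_iota; lia.
Qed.

Lemma left_shiftE x : left_shift x = shiftz 1 x. Proof. by []. Qed.

Lemma shiftz0 x : shiftz 0 x = x.
Proof. by apply/funext => i; rewrite /shiftz addr0. Qed.

Lemma shiftzK l : cancel (shiftz l) (@shiftz A (- l)).
Proof. by move=> x; rewrite -shiftzD addNr shiftz0. Qed.

Lemma shiftzNK l : cancel (shiftz (- l)) (@shiftz A l).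
Proof. by move=> x; rewrite -shiftzD addrN shiftz0. Qed.

Lemma subshift_shiftz S l x : subshift S -> S x -> S (shiftz l x).
Proof.
move=> [_ _ S1].
have fwd y : S y -> S (shiftz 1 y) by move=> Sy; rewrite -S1; exists y.
have bwd y : S y -> S (shiftz (- 1) y).
  by rewrite -{1}S1 => -[z Sz <-]; rewrite left_shiftE shiftzK.
have nat_case (k : int) : (forall y, S y -> S (shiftz k y)) ->
    forall (n : nat) y, S y -> S (shiftz (k *+ n) y).
  move=> Sk n; elim: n => [|n IH] y Sy; first by rewrite shiftz0.
  by rewrite mulrS shiftzD; apply/Sk/IH.
case: (intP l) => [|n|n]; first by rewrite shiftz0.
  by rewrite -natz; exact: nat_case.
by rewrite -natz -mulNrn; exact: nat_case.
Qed.

End windows.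

Lemma card1_eq (T : Type) (X : set T) (a b : T) :
  (X #= `I_1)%card -> X a -> X b -> a = b.
Proof.
move=> /card_set_bijP[f [fX finj _]] Xa Xb.
apply: finj; rewrite ?inE//.
by have /= := fX _ Xa; have /= := fX _ Xb; rewrite !ltnS !leqn0 => /eqP-> /eqP->.
Qed.

Lemma card_le2_eq (T : Type) (X : set T) (a b c : T) :
  (X #<= `I_2)%card -> X a -> X b -> X c -> a <> b -> c = a \/ c = b.
Proof.
move=> /pcard_leP[f] Xa Xb Xc ab.
have lt2 t : X t -> (f t < 2)%N by move=> Xt; exact: (@funS _ _ X `I_2 f _ Xt).
have f_inj t u : X t -> X u -> f t = f u -> t = u.
  by move=> Xt Xu; apply: (@inj _ _ X f); rewrite inE.
have := lt2 _ Xa; have := lt2 _ Xb; have := lt2 _ Xc.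
have : f a <> f b by move=> /f_inj; auto.
have [/f_inj|ca] := eqVneq (f c) (f a); first by left; auto.
have [/f_inj|cb] := eqVneq (f c) (f b); first by right; auto.
by move/eqP: ca; move/eqP: cb; lia.
Qed.

(** * Disagreement patterns of a factor map *)

Section factor_patterns.
Context {B A : pdiscreteTopologicalType}.
Variables (hatS : set (full_shift B)) (S : set (full_shift A)).
Variable pi : full_shift B -> full_shift A.
Hypothesis subshift_hatS : subshift hatS.
Hypothesis subshift_S : subshift S.
Hypothesis factor_pi : factor_map hatS S pi.

Let D := split_set hatS S pi.

Lemma factor_in y : hatS y -> S (pi y).
Proof. by have [_ <- _] := factor_pi => hy; exists y. Qed.

Lemma factor_shiftz l y : hatS y -> pi (shiftz l y) = shiftz l (pi y).
Proof.
have [_ _ pi1] := factor_pi.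
have fwd (n : nat) z : hatS z -> pi (shiftz n%:Z z) = shiftz n%:Z (pi z).
  move=> hz; rewrite -!iter_shift; elim: n => //= n <-.
  by rewrite pi1// iter_shift; exact: subshift_shiftz.
move=> hy; case: (intP l) => [|n|n]; [exact: fwd|exact: fwd|].
have hy' : hatS (shiftz (- n.+1%:Z) y) by exact: subshift_shiftz.
by rewrite -[in RHS](shiftzNK n.+1%:Z y) fwd// shiftzK.
Qed.

Lemma factor_window y n : hatS y -> exists m, forall z, hatS z ->
  window m y z -> window n (pi y) (pi z).
Proof.
move=> hy; have [/subspace_continuousP/(_ y hy) piy _ _] := factor_pi.
have /piy : nbhs (pi y) [set x | window n (pi y) x] by apply/nbhs_windowP; exists n.
move=> /nbhs_windowP[m mP].
by exists m => z hz /mP; exact.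
Qed.

Lemma cluster_pairs (u : nat -> full_shift B * full_shift B) :
  (forall k, hatS (u k).1 /\ hatS (u k).2) ->
  exists y z, [/\ hatS y, hatS z & forall n N,
    exists k, [/\ (N <= k)%N, window n y (u k).1 & window n z (u k).2]].
Proof.
move=> hu; have [finB /closed_windowP cl _] := subshift_hatS.
have finBB : finite_set [set: B * B] by rewrite -setXTT; exact: finite_setX.
have [q qP] := @cluster_windows _ (fun k i => ((u k).1 i, (u k).2 i)) finBB.
pose y : full_shift B := fun i => (q i).1.
pose z : full_shift B := fun i => (q i).2.
have yz n N : exists k,
    [/\ (N <= k)%N, window n y (u k).1 & window n z (u k).2].
  have [k Nk kq] := qP n N; exists k.
  by split=> // i /kq; rewrite /y /z => <-.
exists y, z; split=> //; apply: cl => n; have [k [_ ? ?]] := yz n 0%N.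
  by exists (u k).1 => //; exact: (hu k).1.
by exists (u k).2 => //; exact: (hu k).2.
Qed.

(** A limit of points is mapped to the limit of their images, phrased so that
    the two convergences may be read along a common subsequence. *)
Lemma factor_limit (y : nat -> full_shift B) y' (x : full_shift A) :
  (forall k, hatS (y k)) -> hatS y' ->
  (forall n, exists k, window n y' (y k) /\ window n x (pi (y k))) -> pi y' = x.
Proof.
move=> hy hy' yx; apply: window_eq => n; have [m mP] := factor_window n hy'.
have [k [yk xk]] := yx (maxn n m).
apply: window_trans (window_le (leq_maxl n m) xk) _.
by apply/windowC/mP => //; apply: window_le yk; exact: leq_maxr.
Qed.

Definition pattern (y z : full_shift B) : nat -> bool :=
  fun i => y (i%:Z) != z (i%:Z).

Definition patterns : set (nat -> bool) := [set p |
  exists y z, [/\ hatS y, hatS z, pi y = pi z & p = pattern y z]].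

Lemma pattern_tail k y z :
  tail k (pattern y z) = pattern (shiftz k%:Z y) (shiftz k%:Z z).
Proof. by apply/funext => i; rewrite /tail /pattern /shiftz PoszD addrC. Qed.

(** Closedness is compactness of the fibre product of hatS with itself over S. *)
Lemma patterns_subshift : binary_subshift patterns.
Proof.
split=> [q qP|_ k [y [z [hy hz yz ->]]]]; last first.
  exists (shiftz k%:Z y), (shiftz k%:Z z); rewrite !factor_shiftz// yz.
  by split=> //; [exact: subshift_shiftz|exact: subshift_shiftz|exact: pattern_tail].
have /choice[yz yzP] n : exists u : full_shift B * full_shift B,
    [/\ hatS u.1, hatS u.2, pi u.1 = pi u.2 & agree n (pattern u.1 u.2) q].
  have [_ [y [z [hy hz yz ->]]] pq] := qP n.
  by exists (y, z).
have [y [z [hy hz yzk]]] :=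
  cluster_pairs (fun k => let: And4 h h' _ _ := yzP k in conj h h').
exists y, z; split=> //.
  apply: (@factor_limit (fun k => (yz k).1)) => // [k|n]; first by have [] := yzP k.
  have [m mP] := factor_window n hz.
  have [k [_ yk zk]] := yzk (maxn n m) 0%N; exists k.
  split; first exact: window_le (leq_maxl _ _) yk.
  have [_ hk -> _] := yzP k; apply: mP => //.
  exact: window_le (leq_maxr _ _) zk.
apply/funext => i; have [k [ik yk zk]] := yzk i i.+1.
have [_ _ _ <-//] := yzP k.
by rewrite /pattern yk// zk.
Qed.

Lemma fibre_shiftz l x y : fibre hatS pi x y ->
  fibre hatS pi (shiftz l x) (shiftz l y).
Proof.
by move=> [hy <-]; split; [exact: subshift_shiftz|exact: factor_shiftz].
Qed.

Lemma split_closed : closed D.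
Proof.
have [_ /closed_windowP clS _] := subshift_S.
apply/closed_windowP => x xP; split.
  by apply: clS => n; have [y [Sy _] xy] := xP n; exists y.
have /choice[yz yzP] n : exists u : full_shift B * full_shift B,
    [/\ hatS u.1, hatS u.2, pi u.1 = pi u.2, window n x (pi u.1) &
      u.1 (0 : int) <> u.2 (0 : int)].
  have [w [_ [y [z [[hy yw] [hz zw] yz]]]] xw] := xP n.
  by exists (y, z); rewrite /= yw zw.
have [y [z [hy hz yzk]]] :=
  cluster_pairs (fun k => let: And5 h h' _ _ _ := yzP k in conj h h').
exists y, z; split.
- split=> //; apply: (@factor_limit (fun k => (yz k).1)) => // [k|n].
    by have [] := yzP k.
  have [k [nk yk _]] := yzk n n; exists k; split=> //.
  by have [_ _ _ xk _] := yzP k; exact: window_le xk.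
- split=> //; apply: (@factor_limit (fun k => (yz k).2)) => // [k|n].
    by have [] := yzP k.
  have [k [nk _ zk]] := yzk n n; exists k; split=> //.
  by have [_ _ <- xk _] := yzP k; exact: window_le xk.
have [k [_ yk zk]] := yzk 0%N 0%N.
by have [_ _ _ _] := yzP k; rewrite yk// zk.
Qed.

Hypothesis at_most_2 : forall x, S x -> (fibre hatS pi x #<= `I_2)%card.

(** Here the bound on the fibres matters: a witness that [shiftz l x] lies in
    D shifts back to two points of the fibre of [x], which are [y] and [z]. *)
Lemma split_visits x y z (l : int) : S x ->
  fibre hatS pi x y -> fibre hatS pi x z -> y <> z ->
  D (shiftz l x) <-> y l <> z l.
Proof.
move=> Sx xy xz yz; split=> [[_ [u [v [xu xv uv]]]] ylzl|yzl]; last first.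
  split; first exact: subshift_shiftz.
  exists (shiftz l y), (shiftz l z).
  by split; [exact: fibre_shiftz|exact: fibre_shiftz|rewrite /shiftz add0r].
have back t : fibre hatS pi (shiftz l x) t -> t 0 = y l.
  move=> /(fibre_shiftz (- l)); rewrite shiftzK => xt.
  have tE : t 0 = shiftz (- l) t l by rewrite /shiftz addrN.
  have [] := card_le2_eq (at_most_2 Sx) xy xz xt yz => E; rewrite tE E//.
by apply: uv; rewrite (back u)// (back v).
Qed.

(** If the orbit of [x] meets D then the fibre of [x] has two points, and their
    pattern is the sequence of visits; otherwise the zero pattern, of a point
    paired with itself, describes the visits. *)
Lemma visit_pattern x : S x -> exists2 q, patterns q &
  forall i, q i = `[< D (iter i left_shift x) >].
Proof.
move=> Sx.
have [[i [_ [u [v [xu xv uv]]]]]|nD] := pselect (exists i, D (iter i left_shift x)).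
  move: xu xv; rewrite iter_shift.
  move=> /(fibre_shiftz (- i%:Z)) + /(fibre_shiftz (- i%:Z)).
  rewrite shiftzK => xu xv.
  exists (pattern (shiftz (- i%:Z) u) (shiftz (- i%:Z) v)).
    exists (shiftz (- i%:Z) u), (shiftz (- i%:Z) v); split=> //.
    - by case: xu.
    - by case: xv.
    - by case: xu => _ ->; case: xv => _ ->.
  move=> j; rewrite iter_shift /pattern; apply/idP/asboolP.
    move=> /eqP neq; apply/(split_visits j%:Z Sx xu xv) => // E.
    by apply: neq; rewrite E.
  move=> Dj; apply/eqP; apply/(split_visits j%:Z Sx xu xv) => // E.
  by apply: uv; rewrite -[u](shiftzNK i%:Z) -[v](shiftzNK i%:Z) E.
have [_ imS _] := factor_pi; move: (Sx); rewrite -imS => -[y hy yx].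
exists (pattern y y); first by exists y, y.
move=> i; rewrite /pattern eqxx; apply/esym/negbTE/asboolPn => Di.
by apply: nD; exists i.
Qed.

Lemma pattern_visit q : patterns q -> (exists i, q i) ->
  exists2 x, S x & forall i, q i = `[< D (iter i left_shift x) >].
Proof.
move=> [y [z [hy hz yz ->]]] [i /eqP yzi].
have Sx := factor_in hy; exists (pi y) => // j.
have neq : y <> z by move=> E; apply: yzi; rewrite E.
have sv := split_visits j%:Z Sx (conj hy erefl) (conj hz (esym yz)) neq.
by rewrite /pattern iter_shift; apply/idP/asboolP => [/eqP/sv|/sv/eqP].
Qed.

Lemma sum_visitsE {R : realType} x q n :
  (forall i, q i = `[< D (iter i left_shift x) >]) ->
  \sum_(0 <= i < n) \1_D (iter i left_shift x) = (hits q n)%:R :> R.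
Proof.
move=> qE; rewrite /hits natr_sum.
by apply: eq_bigr => i _; rewrite indicE qE; congr (_%:R); congr nat_of_bool.
Qed.

Hypothesis minimal_S : minimal S.

(** Minimality with bounded gaps: a limit of points that avoid a window of [x0]
    for longer and longer times would have an orbit that is not dense. *)
Lemma syndetic_visits x0 n : S x0 -> exists M : nat, forall x, S x ->
  exists2 l : int, (`|l| <= M)%N & window n x0 (shiftz l x).
Proof.
move=> Sx0; have [finA /closed_windowP clS _] := subshift_S.
apply: contrapT => nM.
have /choice[x xP] M : exists x, S x /\
    forall l : int, (`|l| <= M)%N -> ~ window n x0 (shiftz l x).
  apply: contrapT => nx; apply: nM; exists M => x Sx.
  apply: contrapT => nl; apply: nx; exists x; split=> // l lM xl.
  by apply: nl; exists l.
have [x' x'P] := cluster_windows x finA.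
have Sx' : S x'.
  by apply: clS => m; have [k _ xk] := x'P m 0%N; exists (x k) => //; exact: (xP k).1.
have [_ [[l _ <-] xl]] : Defs.orbit x' `&` [set y | window n x0 y] !=set0.
  by apply: (minimal_S Sx' Sx0); apply/nbhs_windowP; exists n.
have [k lk xk] := x'P (n + `|l|)%N `|l|%N.
apply: ((xP k).2 l lk); apply: window_trans xl _.
exact: window_shiftz.
Qed.

(** By compactness, pairs in a common fibre that disagree on the window [L], over
    points converging to [x0], would yield two points over [x0]. *)
Lemma agreement_near x0 L : (fibre hatS pi x0 #= `I_1)%card ->
  exists n, forall y z, hatS y -> hatS z -> pi y = pi z ->
    window n x0 (pi y) -> window L y z.
Proof.
move=> fib1; apply: contrapT => nn.
have /choice[yz yzP] n : exists u : full_shift B * full_shift B,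
    [/\ hatS u.1, hatS u.2, pi u.1 = pi u.2, window n x0 (pi u.1) &
      ~ window L u.1 u.2].
  apply: contrapT => nu; apply: nn; exists n => y z hy hz yz xy.
  by apply: contrapT => nyz; apply: nu; exists (y, z).
have [y [z [hy hz yzk]]] :=
  cluster_pairs (fun k => let: And5 h h' _ _ _ := yzP k in conj h h').
have piy : pi y = x0.
  apply: (@factor_limit (fun k => (yz k).1)) => // [k|n].
    by have [] := yzP k.
  have [k [nk yk _]] := yzk n n; exists k; split=> //.
  by have [_ _ _ xk _] := yzP k; exact: window_le xk.
have piz : pi z = x0.
  apply: (@factor_limit (fun k => (yz k).2)) => // [k|n].
    by have [] := yzP k.
  have [k [nk _ zk]] := yzk n n; exists k; split=> //.
  by have [_ _ <- xk _] := yzP k; exact: window_le xk.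
have zy : z = y by apply: (card1_eq fib1).
have [k [_ yk zk]] := yzk L 0%N; have [_ _ _ _] := yzP k; apply.
by move=> i iL; rewrite yk// zk// zy.
Qed.

(** The forward orbit of [pi y] comes close to [x0], where the two points of the
    fibre must agree on a long window. *)
Lemma zero_patterns x0 : S x0 -> (fibre hatS pi x0 #= `I_1)%card ->
  zero_blocks patterns.
Proof.
move=> Sx0 fib1 _ L [y [z [hy hz yz ->]]].
have [n nP] := agreement_near L fib1.
have [M MP] := syndetic_visits n Sx0.
(* shifting by M first makes the time of the visit nonnegative *)
have [l lM xl] := MP _ (subshift_shiftz M%:Z subshift_S (factor_in hy)).
have Ml : l + M%:Z = (absz (l + M%:Z))%:Z by lia.
exists (absz (l + M%:Z)) => i iL.
rewrite -[LHS]/(tail _ _ i) pattern_tail -Ml.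
apply/negbTE/negPn/eqP/esym; apply: (nP _ _ _ _ _ _) => //.
- exact: subshift_shiftz.
- exact: subshift_shiftz.
- by rewrite !factor_shiftz// yz.
- by rewrite factor_shiftz// shiftzD.
- by rewrite ltnW.
Qed.

End factor_patterns.

(** * Invariant measures from empirical frequencies *)

Section cylinders.
Context {A : pdiscreteTopologicalType}.
Implicit Types C : set (full_shift A).

(** The algebra of sets that depend on finitely many coordinates.  Over a finite
    alphabet they are compact and open, so that a nonnegative additive function
    on them is a premeasure. *)
Definition cylinder : set (set (full_shift A)) :=
  [set C | exists n, forall x y, window n x y -> C x -> C y].

(** The largest set inside [C] that depends on the coordinates of absolute value
    at most [n] only; these exhaust an open set. *)
Definition inner_cylinder C n : set (full_shift A) :=
  [set x | forall y, window n x y -> C y].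

Lemma cylinder0 : cylinder set0. Proof. by exists 0%N. Qed.

Lemma cylinderT : cylinder setT. Proof. by exists 0%N. Qed.

Lemma cylinderC C : cylinder C -> cylinder (~` C).
Proof.
move=> [n nC]; exists n => x y xy nCx Cy.
by apply/nCx/(nC y x)/Cy/windowC.
Qed.

Lemma cylinderU : setU_closed cylinder.
Proof.
move=> C C' [m mC] [n nC']; exists (maxn m n) => x y xy [Cx|Cx].
  by left; apply: mC Cx; apply: window_le xy; exact: leq_maxl.
by right; apply: nC' Cx; apply: window_le xy; exact: leq_maxr.
Qed.

Lemma cylinderI : setI_closed cylinder.
Proof.
move=> C C' cC cC'; rewrite -[_ `&` _]setCK setCI.
by apply/cylinderC/cylinderU; exact: cylinderC.
Qed.

Lemma cylinder_open C : cylinder C -> open C.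
Proof.
by move=> [n nC]; apply/open_windowP => x Cx; exists n => y xy; exact: nC Cx.
Qed.

Lemma inner_cylinderP C n : cylinder (inner_cylinder C n).
Proof.
by exists n => x y xy Cx z yz; apply: Cx; exact: window_trans yz.
Qed.

Lemma inner_cylinder_sub C n : inner_cylinder C n `<=` C.
Proof. by move=> x; exact. Qed.

Lemma bigcup_inner_cylinder C : open C -> \bigcup_n inner_cylinder C n = C.
Proof.
move=> /open_windowP oC; apply/seteqP; split=> [x [n _]|x /oC[n nC]].
  exact: inner_cylinder_sub.
by exists n.
Qed.

Lemma inner_cylinder_homo C m n : (m <= n)%N ->
  inner_cylinder C m `<=` inner_cylinder C n.
Proof. by move=> mn x Cx y xy; apply: Cx; exact: window_le xy. Qed.

Lemma borel_cylinder (C : set (borel A)) : measurable C -> <<s cylinder >> C.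
Proof.
apply: smallest_sub; first exact: smallest_sigma_algebra.
move=> U oU; rewrite -(bigcup_inner_cylinder oU).
have [_ _ bU] := smallest_sigma_algebra setT cylinder.
by apply: bU => n; apply: sub_gen_smallest; exact: inner_cylinderP.
Qed.

Lemma cylinder_borel (C : set (borel A)) : cylinder C -> measurable C.
Proof. by move=> cC; apply: sub_gen_smallest; exact: cylinder_open. Qed.

Lemma cylinder_shiftz l C : cylinder C -> cylinder (shiftz l @^-1` C).
Proof.
move=> [n nC]; exists (n + `|l|)%N => x y xy; apply: nC.
exact: window_shiftz.
Qed.

Lemma borel_closed (C : set (borel A)) :
  closed (C : set (full_shift A)) -> measurable C.
Proof.
move=> cC; rewrite -[C]setCK; apply: measurableC.
by apply: sub_gen_smallest; exact: closed_openC.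
Qed.

End cylinders.

(** A copy of the full shift that carries the algebra of cylinders, the full
    shift itself being used with its Borel sets. *)
Definition cylinder_space (A : pdiscreteTopologicalType) : Type := full_shift A.

HB.instance Definition _ (A : pdiscreteTopologicalType) :=
  Pointed.on (cylinder_space A).

HB.instance Definition _ (A : pdiscreteTopologicalType) :=
  @isAlgebraOfSets.Build default_measure_display (cylinder_space A)
    (@cylinder A) cylinder0 cylinderU cylinderC.

Section mean_extension.
Context {R : realType} {A : pdiscreteTopologicalType}.
Hypothesis finA : finite_set [set: A].
Variable L : set (full_shift A) -> R.
Hypothesis L_ge0 : forall C, 0 <= L C.
Hypothesis LT : L setT = 1.
Hypothesis L_add : forall C C', C `&` C' = set0 -> L (C `|` C') = L C + L C'.

Lemma mean0 : L set0 = 0.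
Proof.
have := @L_add set0 set0; rewrite setI0 setU0 => /(_ erefl) /eqP.
by rewrite -subr_eq0 opprD addNKr oppr_eq0 => /eqP.
Qed.

Lemma mean_le C C' : C `<=` C' -> L C <= L C'.
Proof.
move=> CC'; rewrite -(setDUK CC') L_add ?lerDl//.
by rewrite setDE setICA setICr setI0.
Qed.

Lemma mean_bigcup (F : (set (full_shift A))^nat) n : trivIset setT F ->
  L (\big[setU/set0]_(0 <= i < n) F i) = \sum_(0 <= i < n) L (F i).
Proof.
move=> tF; elim: n => [|n IH]; first by rewrite !big_geq// mean0.
rewrite !big_nat_recr//= L_add ?IH//.
rewrite big_mkord; apply/seteqP; split=> // x [].
rewrite -bigcup_mkord => -[i /= iN Fi] Fn.
by move: iN; rewrite (tF i n)// ?ltnn//; exists x.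
Qed.

Definition premeasure (C : set (cylinder_space A)) : \bar R := (L C)%:E.

(** Compactness of the full shift: points that are covered later and later
    would accumulate at an uncovered point of the union. *)
Lemma cylinder_partition_finite (F : (set (cylinder_space A))^nat) :
  (forall i, measurable (F i)) -> measurable (\bigcup_i F i) ->
  exists N, \bigcup_i F i = \big[setU/set0]_(0 <= i < N) F i.
Proof.
move=> cF [m mU].
suff [N NP] : exists N, forall x, (\bigcup_i F i) x -> exists2 i, (i < N)%N & F i x.
  exists N; rewrite big_mkord -bigcup_mkord; apply/seteqP; split=> [x|].
    by move=> /NP[i iN Fi]; exists i.
  by move=> x [i _ Fi]; exists i.
apply: contrapT => nN.
have /choice[x xP] N : exists x, (\bigcup_i F i) x /\ forall i, (i < N)%N -> ~ F i x.
  apply: contrapT => nx; apply: nN; exists N => x Ux.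
  apply: contrapT => ni; apply: nx; exists x; split=> // i iN Fi.
  by apply: ni; exists i.
have [x' x'P] := cluster_windows x finA.
have [i _ Fi] : (\bigcup_i F i) x'.
  by have [k _ xk] := x'P m 0%N; apply: mU (xP k).1; exact: windowC xk.
have [n nF] := cF i.
have [k ik xk] := x'P n i.+1.
by apply: ((xP k).2 i ik); exact: nF Fi.
Qed.

Lemma premeasure_sigma_additive : semi_sigma_additive premeasure.
Proof.
move=> F cF tF cU; apply: cvg_near_cst.
have [N NP] := cylinder_partition_finite cF cU.
exists N => // n /= Nn.
rewrite /premeasure sumEFin -mean_bigcup//; congr (L _)%:E.
apply/seteqP; split.
  by rewrite big_mkord -bigcup_mkord => x [i _ Fi]; exists i.
rewrite NP !big_mkord -!bigcup_mkord => x [i /= iN Fi].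
by exists i => //=; exact: leq_trans Nn.
Qed.

Lemma premeasure_ge0 C : (0 <= premeasure C)%E. Proof. by rewrite lee_fin. Qed.

Lemma premeasure0 : premeasure set0 = 0%E. Proof. by rewrite /premeasure mean0. Qed.

HB.instance Definition _ := isMeasure.Build _ _ _ premeasure
  premeasure0 premeasure_ge0 premeasure_sigma_additive.

Definition mean_measure (C : set (borel A)) : \bar R :=
  measure_extension premeasure C.

Let m0 : mean_measure set0 = 0%E. Proof. exact: measure0. Qed.

Let m_ge0 C : (0 <= mean_measure C)%E. Proof. exact: measure_ge0. Qed.

Let m_sigma_additive : semi_sigma_additive mean_measure.
Proof.
move=> F mF tF mU.
apply: (@measure_semi_sigma_additive _ _ _ (measure_extension premeasure)) => //.
  by move=> i; exact: borel_cylinder.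
exact: borel_cylinder.
Qed.

HB.instance Definition _ := isMeasure.Build _ _ _ mean_measure
  m0 m_ge0 m_sigma_additive.

Lemma mean_measure_cylinder C : cylinder C -> mean_measure C = (L C)%:E.
Proof. by move=> cC; rewrite /mean_measure /measure_extension measurable_mu_extE. Qed.

Let mT : mean_measure setT = 1%E.
Proof. by rewrite mean_measure_cylinder ?LT//; exact: cylinderT. Qed.

HB.instance Definition _ := Measure_isProbability.Build _ _ _ mean_measure mT.

Lemma mean_extension : exists mu : probability (borel A) R,
  forall C, cylinder C -> mu C = (L C)%:E.
Proof. by exists mean_measure; exact: mean_measure_cylinder. Qed.

(** A closed set is the complement of an increasing union of cylinders, on which
    measure and mean agree, and the mean is monotone but need not be continuous
    along this union. *)
Lemma mean_le_closed (mu : probability (borel A) R) (C : set (borel A)) :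
  (forall C, cylinder C -> mu C = (L C)%:E) ->
  closed (C : set (full_shift A)) -> ((L C)%:E <= mu C)%E.
Proof.
move=> muL cC; have oC : open (~` C : set (full_shift A)) by exact: closed_openC.
have mC := borel_closed cC.
have : (mu (~` C) <= (1 - L C)%:E)%E.
  have cvgC : mu \o inner_cylinder (~` C) @ \oo --> mu (~` C).
    rewrite -[in X in _ --> X](bigcup_inner_cylinder oC).
    apply: nondecreasing_cvg_mu.
    - by move=> n; apply: cylinder_borel; exact: inner_cylinderP.
    - by rewrite bigcup_inner_cylinder//; exact: measurableC.
    - by move=> m n mn; apply/subsetPset; exact: inner_cylinder_homo.
  rewrite -(cvg_lim _ cvgC)//; apply: lime_le; first by apply: cvgP cvgC.
  apply: nearW => n; rewrite /= muL; last exact: inner_cylinderP.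
  rewrite lee_fin lerBrDr -LT -L_add.
    by apply: mean_le.
  by apply/seteqP; split=> // x [] /inner_cylinder_sub.
rewrite probability_setC// -(fineK (fin_num_measure mu C mC)) -EFinB !lee_fin.
lra.
Qed.

End mean_extension.

(** Images under the left shift are preimages under its inverse, which makes
    [fun C => mu (left_shift @` C)] the distribution of a measurable map. *)
Definition right_shift {A : pdiscreteTopologicalType} : borel A -> borel A :=
  @shiftz A (- 1).

Lemma right_shift_measurable (A : pdiscreteTopologicalType) :
  measurable_fun setT (@right_shift A).
Proof.
apply: (@measurability _ _ (borel A) (borel A) setT right_shift
  (@open (full_shift A))) => // _ [U oU <-].
rewrite setTI; apply: sub_gen_smallest; apply/open_windowP => x Ux.
have /open_windowP/(_ _ Ux)[n nU] := oU.
by exists (n + 1)%N => y xy; apply/nU/window_shiftz.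
Qed.

HB.instance Definition _ (A : pdiscreteTopologicalType) :=
  isMeasurableFun.Build _ _ (borel A) (borel A) (@right_shift A)
    (@right_shift_measurable A).

Lemma image_left_shift (A : pdiscreteTopologicalType) (C : set (full_shift A)) :
  left_shift @` C = right_shift @^-1` C.
Proof.
apply/seteqP; split=> [_ [x Cx <-]|x Cx].
  by rewrite /= left_shiftE /right_shift shiftzK.
exists (right_shift x) => //.
by rewrite left_shiftE /right_shift -{1}[1]opprK shiftzK.
Qed.

Lemma cylinder_invariant {R : realType} (A : pdiscreteTopologicalType)
    (mu : probability (borel A) R) :
  (forall C, cylinder C -> mu (right_shift @^-1` C) = mu C) ->
  forall C : set (borel A), measurable C -> mu C = mu (left_shift @` C).
Proof.
move=> muC C mC; rewrite image_left_shift.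
rewrite -[RHS]/(distribution mu right_shift C).
apply: (@g_sigma_algebra_measure_unique _ _ (borel A) (@cylinder A) _ (fun=> setT)).
- by move=> D; exact: cylinder_borel.
- by move=> _; exact: cylinderT.
- by rewrite bigcup_const//; exists 0%N.
- exact: cylinderI.
- by move=> D cD; exact: esym (muC D cD).
- by move=> _; apply: (@le_lt_trans _ _ 1%E); [exact: probability_le1|exact: ltry].
- exact: borel_cylinder.
Qed.

(** An ultrafilter converges to each of its cluster points. *)
Lemma ultra_cvg {R : realType} (G : set_system nat) (u : nat -> R) :
  UltraFilter G -> (forall k, 0 <= u k <= 1) -> cvg (u @ G).
Proof.
move=> GU u01; have := @segment_compact R 0 1.
move=> /(_ (u @ G) _)[|p [_ pG]].
  apply: (@filterS _ G _ setT) => [k _|]; last exact: filterT.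
  by rewrite /= in_itv /=; exact: u01.
apply/cvg_ex; exists p => V Vp.
have [//|GV] := in_ultra_setVsetC (u @^-1` V) GU.
by have [x []] := pG (~` V) V GV Vp.
Qed.

Section empirical_mean.
Context {R : realType} {A : pdiscreteTopologicalType}.
Implicit Types (C : set (full_shift A)) (x : full_shift A).

Lemma visit_freq01 C n x : 0 <= (visit_freq C n x : R) <= 1.
Proof.
have s0 : 0 <= \sum_(0 <= i < n) \1_C (iter i left_shift x) :> R.
  by apply: sumr_ge0 => i _.
have sn : \sum_(0 <= i < n) \1_C (iter i left_shift x) <= n%:R :> R.
  rewrite -[X in _ <= X%:R](subn0 n) -sumr_const_nat; apply: ler_sum => i _.
  by rewrite indicE; case: (_ \in _).
rewrite mulr_ge0//= /visit_freq; case: n sn {s0} => [|n] sn.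
  by rewrite invr0 mul0r.
by rewrite mulrC ler_pdivrMr// mul1r.
Qed.

Lemma visit_freqU C C' n x : C `&` C' = set0 ->
  visit_freq (C `|` C') n x = visit_freq C n x + visit_freq C' n x :> R.
Proof.
move=> CC'; rewrite /visit_freq -mulrDr -big_split /=; congr (_ * _).
apply: eq_bigr => i _; rewrite !indicE in_setU -natrD; congr (_%:R).
have [Cy|_] := boolP (_ \in C); last by [].
have [C'y|_] := boolP (_ \in C'); last by [].
by have : set0 (iter i left_shift x) by rewrite -CC'; split; exact: set_mem.
Qed.

Lemma visit_freqT n x : (0 < n)%N -> visit_freq setT n x = 1 :> R.
Proof.
move=> n0; rewrite /visit_freq (eq_bigr (fun=> 1)).
  by rewrite sumr_const_nat subn0 mulVf// pnatr_eq0 -lt0n.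
by move=> i _; rewrite indicT.
Qed.

Lemma visit_freq_shift C n x :
  `|visit_freq (left_shift @^-1` C) n x - visit_freq C n x| <= n%:R^-1 :> R.
Proof.
rewrite /visit_freq -mulrBr normrM ger0_norm ?invr_ge0// -sumrB.
rewrite (eq_bigr (fun i =>
  \1_C (iter i.+1 left_shift x) - \1_C (iter i left_shift x))).
  rewrite telescope_sumr//; apply: ler_piMr; first by rewrite invr_ge0.
  rewrite !indicE; case: (_ \in _); case: (_ \in _);
  by rewrite ?subrr ?subr0 ?sub0r ?normrN ?normr1 ?normr0.
by move=> i _; rewrite !indicE /=; congr ((nat_of_bool _)%:R - _).
Qed.

(** The Krylov-Bogoliubov argument.  Choose times along which the frequency of
    visits to [D] tends to [b], and take limits of all frequencies along a free
    ultrafilter.  A shift changes a frequency over [n] steps by at most [1 / n],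
    so the resulting mean is invariant; it gives mass 1 to [S], which is
    closed, and mass [b] to [D]. *)
Theorem limit_freq_measure (S D : set (full_shift A)) x (b : R) :
  subshift S -> S x -> closed D ->
  (forall N, (0 < N)%N ->
    closure [set visit_freq D n x | n in [set n | (N <= n)%N]] b) ->
  exists2 mu : probability (borel A) R, invariant_measure S mu & (b%:E <= mu D)%E.
Proof.
move=> sS Sx cD bP.
have /choice[n nP] k : exists n, (k < n)%N /\
    `|b - visit_freq D n x| < k.+1%:R^-1.
  have kb : nbhs b (ball b (k.+1%:R^-1 : R)).
    by apply: nbhsx_ballx; rewrite invr_gt0.
  have [_ [[n /= kn <-]]] := bP k.+1 isT _ kb.
  by rewrite -ball_normE; exists n.
have [G [GU ooG]] := @ultraFilterLemma _ (\oo : set_system nat) _.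
pose u C k : R := visit_freq C (n k) x.
have cu C : cvg (u C @ G) by apply: ultra_cvg => k; exact: visit_freq01.
pose L C : R := lim (u C @ G).
have uL C : u C @ G --> L C by exact: cu.
have L_eq C (l : R) : u C @ G --> l -> L C = l by exact: cvg_lim.
have inv_cvg : (k.+1%:R^-1 : R) @[k --> G] --> 0.
  exact: cvg_trans (cvg_app _ ooG) (@cvg_harmonic R).
have LT : L setT = 1.
  apply: L_eq; apply: cvg_near_cst; apply: filterS filterT => k _.
  by rewrite /u visit_freqT//; apply: leq_ltn_trans (nP k).1.
have L_ge0 C : 0 <= L C.
  apply: limr_ge => //; apply: filterS filterT => k _.
  by have /andP[] := visit_freq01 C (n k) x.
have L_add C C' : C `&` C' = set0 -> L (C `|` C') = L C + L C'.
  move=> CC'; apply: L_eq.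
  rewrite (_ : u (C `|` C') = u C \+ u C'); first exact: cvgD.
  by apply/funext => k; rewrite /u visit_freqU.
have LD : L D = b.
  apply: L_eq; apply/cvgrPdist_lt => e e0.
  have /cvgrPdist_lt/(_ e e0) := inv_cvg.
  apply: filterS => k; rewrite sub0r normrN ger0_norm ?invr_ge0//.
  exact: lt_trans (nP k).2.
have LS : L S = 1.
  apply: L_eq; apply: cvg_near_cst; apply: filterS filterT => k _.
  rewrite /u -(@visit_freqT (n k) x); last by apply: leq_ltn_trans (nP k).1.
  congr (_ * _); apply: eq_bigr => i _.
  by rewrite !indicE !mem_set// iter_shift; exact: subshift_shiftz.
have L_shift C : L (left_shift @^-1` C) = L C.
  apply: L_eq.
  have d0 : (u (left_shift @^-1` C) \- u C) @ G --> (0 : R).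
    apply/cvgrPdist_lt => e e0.
    have /cvgrPdist_lt/(_ e e0) := inv_cvg.
    apply: filterS => k; rewrite !sub0r !normrN ger0_norm ?invr_ge0//.
    apply: le_lt_trans; apply: le_trans (visit_freq_shift C (n k) x) _.
    by rewrite lef_pV2 ?posrE ?ltr0n ?ler_nat ?(nP k).1// (leq_ltn_trans _ (nP k).1).
  rewrite (_ : u _ = (u (left_shift @^-1` C) \- u C) \+ u C).
    by rewrite -[L C]add0r; exact: cvgD.
  by apply/funext => k /=; rewrite subrK.
have [finA cS _] := sS.
have [mu muL] := mean_extension finA L_ge0 LT L_add.
have muD C := @mean_le_closed _ _ L L_ge0 LT L_add mu C muL.
exists mu; last by rewrite -LD; exact: muD.
split.
  apply/eqP; rewrite eq_le probability_le1/=; last exact: borel_closed.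
  by rewrite -LS; exact: muD.
move=> C mC _; apply: cylinder_invariant => // C' cC'.
rewrite !muL//; last exact: cylinder_shiftz.
congr EFin; rewrite -L_shift; congr L.
by apply/seteqP; split=> y; rewrite /= /right_shift left_shiftE shiftzK.
Qed.

End empirical_mean.

Lemma shiftz_closed (A : pdiscreteTopologicalType) l (C : set (full_shift A)) :
  closed C -> closed (shiftz l @^-1` C).
Proof.
move=> /closed_windowP cC; apply/closed_windowP => x xP; apply: cC => n.
have [y Cy xy] := xP (n + `|l|)%N.
by exists (shiftz l y) => //; exact: window_shiftz.
Qed.

Section visit_bound.
Context {R : realType} {A : pdiscreteTopologicalType}.

(** The invariance hypothesis speaks of images of subsets of [S] under the left
    shift, so it is applied to the preimages of [D], which lie in [S]. *)
Lemma invariant_visits (S D : set (full_shift A)) (mu : probability (borel A) R) i :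
  subshift S -> D `<=` S -> closed D -> invariant_measure S mu ->
  mu (shiftz i%:Z @^-1` D) = mu D.
Proof.
move=> sS DS cD [_ invmu]; elim: i => [|i <-].
  by congr (mu _); apply/seteqP; split=> x; rewrite /= shiftz0.
have sub : shiftz i.+1%:Z @^-1` D `<=` S.
  move=> x /DS Sx; rewrite -(shiftzK i.+1%:Z x); exact: subshift_shiftz.
rewrite invmu//; last by exact: (borel_closed (shiftz_closed cD)).
congr (mu _); rewrite image_left_shift; apply/seteqP; split=> x;
by rewrite /= /right_shift -shiftzD; have -> : i.+1%:Z + -1 = i%:Z by lia.
Qed.

(** Integrate the number of visits during [n] steps. *)
Lemma visit_bound (S D : set (full_shift A)) (mu : probability (borel A) R)
    n (c : R) :
  subshift S -> D `<=` S -> closed D -> invariant_measure S mu -> 0 <= c ->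
  (forall x, S x -> \sum_(0 <= i < n) \1_D (iter i left_shift x) <= c) ->
  n%:R * fine (mu D) <= c.
Proof.
move=> sS DS cD inv c0 cP.
pose V i : set (borel A) := shiftz i%:Z @^-1` D.
have mV i : measurable (V i).
  by exact: (borel_closed (shiftz_closed cD)).
have muV i : mu (V i) = mu D by exact: invariant_visits inv.
have mD : measurable (D : set (borel A)) by exact: borel_closed.
have sumV : (\int[mu]_x (\sum_(i <- index_iota 0 n) (\1_(V i) x)%:E) =
    (n%:R * fine (mu D))%:E)%E.
  rewrite ge0_integral_sum//; last first.
    by move=> i; apply/measurable_EFinP; exact: measurable_indic.
  rewrite (eq_bigr (fun=> (fine (mu D))%:E)).
    by rewrite sumEFin sumr_const_nat subn0 mulr_natl.
  move=> i _; rewrite integral_indic// setIT fineK ?fin_num_measure//.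
  exact: muV.
have : (\int[mu]_x (\sum_(i <- index_iota 0 n) (\1_(V i) x)%:E)
    <= \int[mu]_x (cst c%:E x))%E.
  apply: ge0_le_integral => //.
  - by move=> x _; apply: sume_ge0 => i _; rewrite lee_fin.
  - by apply: emeasurable_sum => i; apply/measurable_EFinP; exact: measurable_indic.
  - move=> x _; rewrite sumEFin lee_fin.
    have [Sx|nSx] := pselect (S x).
      apply: le_trans (cP x Sx); apply: ler_sum => i _.
      by rewrite iter_shift.
    rewrite big1// => i _; rewrite indicE memNset// => /DS Six.
    by apply: nSx; rewrite -(shiftzK i%:Z x); exact: subshift_shiftz.
rewrite sumV integral_cst//= probability_setT mule1 lee_fin//.
Qed.

End visit_bound.

(** * The set of limit frequencies *)

Theorem theorem1 (R : realType) (B A : pdiscreteTopologicalType)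
    (hatS : set (full_shift B)) (S : set (full_shift A))
    (pi : full_shift B -> full_shift A)
    (subshift_hatS : subshift hatS) (minimal_hatS : minimal hatS)
    (subshift_S : subshift S) (minimal_S : minimal S)
    (factor_pi : factor_map hatS S pi)
    (almost_1to1 : exists2 x, S x & (fibre hatS pi x #= `I_1)%card)
    (at_most_2 : forall x, S x -> (fibre hatS pi x #<= `I_2)%card) :
  let D := split_set hatS S pi in
  limit_freqs S D =
  [set` `[0 : R, sup [set fine (mu D) |
     mu in [set mu : probability (borel A) R | invariant_measure S mu]]]].
Proof.
move=> D; set E := (X in sup X).
have cD : closed D by exact: split_closed.
have DS : D `<=` S by move=> x [].
have mD := borel_closed cD : measurable (D : set (borel A)).
have E_le1 r : E r -> r <= 1.
  move=> [mu _ <-]; rewrite -lee_fin fineK ?fin_num_measure//.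
  exact: probability_le1.
have visit := visit_pattern subshift_hatS subshift_S factor_pi at_most_2.
apply/seteqP; split=> a.
  move=> [x Sx xa]; rewrite /= in_itv/=; apply/andP; split.
    rewrite leNgt; apply/negP => a0.
    have Na0 : 0 < - a by rewrite oppr_gt0.
    have [_ [[n /= _ <-]]] := xa 1%N isT _ (nbhsx_ballx a _ Na0).
    rewrite -ball_normE/= ltr_norml => /andP[+ _].
    by have /andP[] := visit_freq01 (R := R) D n x; lra.
  have [mu inv amu] := limit_freq_measure subshift_S Sx cD xa.
  apply: (@le_trans _ _ (fine (mu D))).
    by rewrite -lee_fin fineK ?fin_num_measure.
  by apply: ub_le_sup; [exists 1|exists mu].
rewrite /= in_itv/= => /andP[a0 aE].
have [x0 Sx0 fib1] := almost_1to1.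
have [a_eq0|a_neq0] := eqVneq a 0.
  exists x0 => // N _; apply: subset_closure; exists N => //=.
  rewrite a_eq0 /visit_freq big1 ?mulr0// => i _.
  rewrite indicE memNset// iter_shift => -[_ [y [z [xy xz]]]]; apply.
  have back t : fibre hatS pi (shiftz i%:Z x0) t ->
      fibre hatS pi x0 (shiftz (- i%:Z) t).
    move=> /(fibre_shiftz subshift_hatS factor_pi (- i%:Z)).
    by rewrite shiftzK.
  rewrite -[y](shiftzNK i%:Z) -[z](shiftzNK i%:Z).
  by rewrite (card1_eq fib1 (back _ xy) (back _ xz)).
have {a0 a_neq0} a0 : 0 < a by rewrite lt_neqAle eq_sym a_neq0.
have hX : heavy a (patterns hatS pi).
  move=> n; apply: contrapT => nX.
  have lt_an q : patterns hatS pi q -> (hits q n)%:R < a * n%:R.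
    by move=> Xq; rewrite ltNge; apply/negP => qn; apply: nX; exists q.
  have [q0 Xq0 _] := visit _ Sx0.
  have n0 : (0 < n)%N.
    by case: n {nX} lt_an => // /(_ _ Xq0); rewrite hits0 mulr0 ltxx.
  have [e e0 eP] := integer_gap a n.
  have ane : 0 <= a * n%:R - e.
    by apply: le_trans (eP _ _ (leqnn n) (lt_an _ Xq0)).
  (* if no pattern has a n ones, all measures of D stay below a by e / n *)
  have : sup E <= a - e / n%:R.
    have [->|/set0P E0] := eqVneq E set0.
      by rewrite sup0 subr_ge0 ler_pdivrMr ?ltr0n// -subr_ge0.
    apply: ge_sup => // _ [mu inv <-].
    have : n%:R * fine (mu D) <= a * n%:R - e.
      apply: (visit_bound subshift_S DS cD inv ane) => x Sx.
      have [q Xq qD] := visit _ Sx.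
      by rewrite (sum_visitsE n qD); exact: eP (lt_an _ Xq).
    by move=> h; rewrite lerBrDr -lerBrDl ler_pdivrMr ?ltr0n// mulrBl; lra.
  by rewrite leNgt (lt_le_trans _ aE)// ltrBlDr ltrDl divr_gt0 ?ltr0n.
have [q Xq qa] := intermediate_density (ltW a0)
  (patterns_subshift subshift_hatS factor_pi) hX
  (zero_patterns subshift_hatS subshift_S factor_pi minimal_S Sx0 fib1).
(* q is nonzero because a > 0, so it describes the visits of a point of S *)
have q1 : exists i, q i.
  apply: contrapT => nq.
  have [m m0] := qa (a / 2) 1%N (divr_gt0 a0 (ltr0n _ 2)).
  rewrite /excess hits_eq0 => [|i _]; last by apply/negP => qi; apply: nq; exists i.
  rewrite sub0r normrN ger0_norm; last by rewrite mulr_ge0// ltW.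
  have : 0 < a * m%:R by rewrite mulr_gt0// ltr0n.
  lra.
have [x Sx qD] := pattern_visit subshift_hatS subshift_S factor_pi at_most_2 Xq q1.
exists x => // N N0 V /nbhs_ballP[e /= e0 eV].
have e20 : 0 < e / 2 by rewrite divr_gt0.
have [m Nm qm] := qa _ N e20.
exists (visit_freq D m x); split; first by exists m.
apply: eV; rewrite -ball_normE/= /visit_freq (sum_visitsE m qD).
have m0 : 0 < m%:R :> R by rewrite ltr0n (leq_trans N0).
rewrite distrC -(mulfK (lt0r_neq0 m0) a) [X in X - _]mulrC -mulrBl normrM.
rewrite normfV (gtr0_norm m0) ltr_pdivrMr//.
by apply: le_lt_trans qm _; rewrite ltr_pM2r//; lra.
Qed.
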